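(* There is an absolute constant $C>0$ such that the following holds. Let $\ell$ be a prime number, $d\ge 1$ an integer, and $n\ge Cd\log d$. If $\mathcal A$ is a $d$-defect $\ell$-oddtown in $[n]$, then $|\mathcal A|\le (d+1)\left(n-2\left(\lceil\log_2(d+2)\rceil-1\right)\right)$.
   Context: A family $\mathcal A=\{A_1,\ldots,A_m\}$ of distinct subsets of $[n]$ is a $d$-defect $\ell$-oddtown if for every $i\in[m]$ we have $|A_i|\not\equiv 0 \pmod \ell$ and there are at most $d$ indices $j\in[m]\setminus\{i\}$ with $|A_i\cap A_j|\not\equiv 0\pmod\ell$.
   Formalization: For d=1 the condition n ≥ C d log d is vacuous and the bound 2(n−2) fails (the n singletons for n ≤ 3), so for d=1 it is additionally assumed that n ≥ C; for d ≥ 2 the statement is unchanged. *)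

(* Defs.v *)
From mathcomp Require Import all_boot all_order all_algebra.
From mathcomp Require Import reals exp.

Set Implicit Arguments.
Unset Strict Implicit.
Unset Printing Implicit Defensive.

Import Order.TTheory GRing.Theory Num.Theory.

Local Open Scope ring_scope.

(* A family of distinct subsets of [n] is a set of sets, so the indices
   j != i of the indexed family are the members B != A. *)
Definition defect_oddtown (d l n : nat) (F : {set {set 'I_n}}) : Prop :=
  forall A : {set 'I_n}, A \in F ->
    ~~ (l %| #|A|)%N /\
    (#|[set B in F | (B != A) && ~~ (l %| #|A :&: B|)%N]| <= d)%N.

Definition log2 (R : realType) (x : R) : R := ln x / ln 2.

(* Main.v *)
(* Join two members of the family when their intersection has size nonzero mod
   l, and let S be a maximum independent set. Characteristic vectors of S are
   orthogonal and non-isotropic over F_l, so r := |S| <= n. Counting edges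
   between S and the family, a family larger than the bound forces r > n - 2s,
   where s = trunc_log 2 (d + 1), and all but O(d s) members A of S to be "good":
   the closed neighbourhood of A has d + 1 elements, none of which has another
   neighbour in S. By maximality of S these neighbourhoods are pairwise
   non-adjacent cliques. Let U_A be the span of the components orthogonal to A
   of the neighbours of A. The spaces U_A are mutually orthogonal and
   orthogonal to S, and there are more than n - r of them, so one of them is
   totally isotropic, whence 2 dim U_A + r <= n and dim U_A < s. But then
   A + U_A has dimension at most s, hence contains at most 2^s 0/1 vectors,
   whereas it contains 0 and the d + 1 >= 2^s neighbours of A. *)
Require Import Defs.
From mathcomp Require Import all_boot all_order all_algebra.
From mathcomp Require Import zify ring lra.
From mathcomp Require Import reals exp.

Import Order.TTheory GRing.Theory Num.Theory.

(** * Maximum independent sets in a graph of bounded degree *)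

Section Graph.
Set Implicit Arguments.
Unset Strict Implicit.

Variables (T : finType) (e : rel T) (F : {set T}) (k : nat).
Hypothesis e_sym : symmetric e.

Definition nbhd (A : T) : {set T} := [set B in F | e A B].

Definition independent (S : {set T}) : bool :=
  [forall A in S, forall B in S, (A != B) ==> ~~ e A B].

Hypothesis e_refl : {in F, forall A, e A A}.
Hypothesis nbhd_le : {in F, forall A, #|nbhd A| <= k}.

Lemma independentP (S : {set T}) :
  reflect {in S &, forall A B, A != B -> ~~ e A B} (independent S).
Proof.
apply: (iffP forall_inP) => [H A B AS BS nAB | H A AS].
  by have /forall_inP/(_ B BS)/implyP := H A AS; apply.
by apply/forall_inP => B BS; apply/implyP; apply: H.
Qed.

(** [S] has maximum size, and [G] holds the members with a full neighbourhood in which no vertex has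
    a second neighbour in [S]. Maximality turns these neighbourhoods into cliques of the largest
    allowed size, so every vertex of one has that clique as its own neighbourhood. *)
Lemma maximum_independent_good :
  exists S G : {set T},
    [/\ S \subset F, independent S, G \subset S,
        2 * #|F| + #|S :\: G| <= 2 * (#|S| * k)
      & {in G, forall A, #|nbhd A| = k /\
          {in nbhd A, forall B, [disjoint nbhd B & S :\ A]
             /\ {in G, forall A', A' != A -> [disjoint nbhd B & nbhd A']}}}].
Proof.
pose P (S : {set T}) := (S \subset F) && independent S.
have P0 : P set0.
  by rewrite /P sub0set; apply/independentP => A B; rewrite inE.
case: (arg_maxnP (fun S : {set T} => #|S|) P0) => S /andP[SF indS] Smax.
have inS := independentP _ indS.
have eS A B : A \in S -> B \in S -> e A B -> A = B.
  by move=> AS BS eAB; apply/eqP/negPn/negP => /(inS _ _ AS BS); rewrite eAB.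
pose dS B := #|[set A in S | e A B]|.
have dS_gt0 B : B \in F -> 0 < dS B.
  move=> BF; rewrite lt0n cards_eq0; apply/negP => /eqP d0.
  have nB A : A \in S -> ~~ e A B.
    by move=> AS; apply/negP => eAB; have := in_set0 A; rewrite -d0 inE AS eAB.
  have BS : B \notin S by apply/negP => /nB; rewrite e_refl.
  (* A vertex without neighbours in [S] could be added to [S]. *)
  have /Smax : P (B |: S).
    rewrite /P subUset sub1set BF SF /=; apply/independentP => X Y.
    rewrite !inE => /predU1P[->|XS] /predU1P[->|YS]; rewrite ?eqxx // => nXY.
    - by rewrite e_sym nB.
    - by rewrite nB.
    - exact: inS.
  by rewrite cardsU1 BS; lia.
pose G := [set A in S | (#|nbhd A| == k) && [forall B in nbhd A, dS B == 1]].
have GS : G \subset S by apply/subsetP => A; rewrite inE => /andP[].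
have uniqS A B A' : A \in G -> B \in nbhd A -> A' \in S -> e A' B -> A' = A.
  rewrite inE => /and3P[AS _ /forall_inP dA] Bn A'S eA'B.
  have /cards1P[X EX] := dA _ Bn.
  move: Bn; rewrite inE => /andP[_ eAB].
  have : A \in [set X] by rewrite -EX inE AS.
  have : A' \in [set X] by rewrite -EX inE A'S.
  by rewrite !inE => /eqP-> /eqP->.
have clique A B C : A \in G -> B \in nbhd A -> C \in nbhd A -> e B C.
  move=> AG Bn Cn; apply/negPn/negP => nBC.
  have AS := subsetP GS _ AG.
  have [BF eAB] : B \in F /\ e A B by move: Bn; rewrite inE => /andP.
  have [CF eAC] : C \in F /\ e A C by move: Cn; rewrite inE => /andP.
  have nBA : B != A by apply: contraNneq nBC => ->.
  have nCA : C != A by apply: contraNneq nBC => ->; rewrite e_sym.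
  have nBCe : B != C by apply: contraNneq nBC => <-; rewrite e_refl.
  have BS : B \notin S by apply: contraNN nBA => BS; rewrite (eS _ _ AS BS eAB).
  have CS : C \notin S by apply: contraNN nCA => CS; rewrite (eS _ _ AS CS eAC).
  have nSB X : X \in S :\ A -> ~~ e X B.
    by rewrite !inE => /andP[nXA XS];
      apply: contraNN nXA => /(uniqS _ _ _ AG Bn XS)->.
  have nSC X : X \in S :\ A -> ~~ e X C.
    by rewrite !inE => /andP[nXA XS];
      apply: contraNN nXA => /(uniqS _ _ _ AG Cn XS)->.
  (* Since [A] is the only neighbour of [B] and [C] in [S], trading [A] for this non-adjacent pair
     would enlarge [S]. *)
  have /Smax : P (B |: (C |: S :\ A)).
    apply/andP; split.
      by rewrite !subUset !sub1set BF CF (subset_trans (subD1set _ _)).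
    apply/independentP => X Y; rewrite in_setU1 (in_setU1 X) in_setU1 (in_setU1 Y).
    move=> /predU1P[->|/predU1P[->|XS]] /predU1P[->|/predU1P[->|YS]];
      rewrite ?eqxx // => nXY.
    - by rewrite e_sym nSB.
    - by rewrite e_sym.
    - by rewrite e_sym nSC.
    - exact: nSB.
    - exact: nSC.
    - by move: XS YS; rewrite !inE => /andP[_ XS] /andP[_ YS]; apply: inS.
  rewrite !cardsU1 !inE (negbTE nBCe) (negbTE BS) (negbTE CS) !andbF /=.
  by rewrite (cardsD1 A S) AS /= !add1n ltnn.
have nbhdE A B : A \in G -> B \in nbhd A -> nbhd B = nbhd A.
  move=> AG Bn; have BF : B \in F by move: Bn; rewrite inE => /andP[].
  have kA : #|nbhd A| = k by move: AG; rewrite inE => /and3P[_ /eqP].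
  apply/esym/eqP; rewrite eqEcard kA nbhd_le // andbT.
  apply/subsetP => C Cn; rewrite inE (clique A) // andbT.
  by move: Cn; rewrite inE => /andP[].
exists S, G; split => //.
  (* Double counting with weights such that dS B * w B >= 2: only the good A
     can have total weight 2 * k around them. *)
- pose w B := if dS B == 1 then 2 else 1.
  have w2 B : w B <= 2 by rewrite /w; case: ifP.
  have dw B : B \in F -> 2 <= dS B * w B.
    by move=> /dS_gt0; rewrite /w; case: eqP => [->|]; lia.
  have double : \sum_(B in F) dS B * w B = \sum_(A in S) \sum_(B in nbhd A) w B.
    under eq_bigr do rewrite /dS -sum_nat_const.
    rewrite (exchange_big_dep [in S]) /=; last first.
      by move=> B A _; rewrite inE => /andP[].
    apply: eq_bigr => A AS; apply: eq_bigl => B.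
    by rewrite !inE AS.
  have le1 : 2 * #|F| <= \sum_(A in S) \sum_(B in nbhd A) w B.
    rewrite -double mulnC -sum_nat_const; exact: leq_sum.
  have nw A : A \in S -> \sum_(B in nbhd A) w B <= 2 * k.
    move=> AS; apply: (@leq_trans (\sum_(B in nbhd A) 2)); first exact: leq_sum.
    by rewrite sum_nat_const mulnC leq_mul2l nbhd_le // (subsetP SF).
  have nwb A : A \in S -> A \notin G -> \sum_(B in nbhd A) w B < 2 * k.
    move=> AS; have AF := subsetP SF _ AS; rewrite inE AS /=.
    have := nbhd_le AF; rewrite leq_eqVlt => /orP[/eqP Ek | lt _]; last first.
      apply: (@leq_ltn_trans (\sum_(B in nbhd A) 2)); first exact: leq_sum.
      by rewrite sum_nat_const mulnC ltn_mul2l.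
    (* With [k] neighbours, [A] can only fail to be good through some [B] with [dS B != 1], whose
       weight is 1 instead of 2. *)
    rewrite Ek eqxx /= negb_forall => /existsP[B].
    rewrite negb_imply => /andP[Bn dB].
    rewrite (bigD1 B) //= {1}/w (negbTE dB) -Ek.
    have : \sum_(C in nbhd A | C != B) w C <= \sum_(C in nbhd A | C != B) 2.
      exact: leq_sum.
    have : \sum_(C in nbhd A) 2 = 2 + \sum_(C in nbhd A | C != B) 2.
      by rewrite (bigD1 B).
    rewrite sum_nat_const; lia.
  have : \sum_(A in S) (\sum_(B in nbhd A) w B + (A \notin G))
      <= \sum_(A in S) 2 * k.
    apply: leq_sum => A AS; case: (boolP (A \in G)) => [AG|/(nwb _ AS)] /=.
      by rewrite addn0 nw.
    by rewrite addn1.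
  rewrite big_split /= sum_nat_const.
  have -> : \sum_(A in S) (A \notin G : nat) = #|S :\: G|.
    rewrite -sum1_card big_mkcond [RHS]big_mkcond; apply: eq_bigr => A _ /=.
    by rewrite in_setD; case: (A \in S); case: (A \in G).
  by rewrite mulnCA => le2; apply: leq_trans le2; rewrite leq_add2r.
- move=> A AG; split; first by move: AG; rewrite inE => /and3P[_ /eqP].
  move=> B Bn; rewrite (nbhdE A) //; split.
    rewrite -setI_eq0; apply/eqP/setP => C; rewrite !inE.
    apply/negP => /and3P[/andP[CF eAC] nCA CS].
    by rewrite (eS _ _ (subsetP GS _ AG) CS eAC) eqxx in nCA.
  move=> A' A'G nA'; rewrite -setI_eq0; apply/eqP/setP => C; rewrite !inE.
  apply/negP => /andP[/andP[CF eAC] /andP[_ eA'C]].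
  have Cn : C \in nbhd A by rewrite inE CF.
  by rewrite (uniqS _ _ _ AG Cn (subsetP GS _ A'G) eA'C) eqxx in nA'.
Qed.
End Graph.

Local Open Scope ring_scope.

(** * Orthogonality, isotropic subspaces and 0/1 vectors over a field *)

Section Linear.
Set Implicit Arguments.
Unset Strict Implicit.
Variables (K : fieldType) (n : nat).

Definition dot (x y : 'rV[K]_n) : K := (x *m y^T) 0 0.

Lemma dotC (x y : 'rV[K]_n) : dot x y = dot y x.
Proof. by rewrite /dot !mxE; apply: eq_bigr => i _; rewrite !mxE mulrC. Qed.

Lemma dotBl (x y z : 'rV[K]_n) : dot (x - y) z = dot x z - dot y z.
Proof. by rewrite /dot mulmxBl !mxE. Qed.

Lemma dotZl a (x z : 'rV[K]_n) : dot (a *: x) z = a * dot x z.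
Proof. by rewrite /dot -scalemxAl mxE. Qed.

Definition row_family (I : finType) (x : I -> 'rV[K]_n) : 'M[K]_(#|I|, n) :=
  \matrix_(i < #|I|) x (enum_val i).

Lemma row_family_mul (I J : finType) (x : I -> 'rV[K]_n) (y : J -> 'rV[K]_n) i j :
  (row_family x *m (row_family y)^T) i j = dot (x (enum_val i)) (y (enum_val j)).
Proof.
by rewrite /dot !mxE; apply: eq_bigr => k _; rewrite !mxE.
Qed.

Lemma row_family_sub (I : finType) (x : I -> 'rV[K]_n) i : (x i <= row_family x)%MS.
Proof.
by rewrite -[x i](_ : row (enum_rank i) (row_family x) = _) ?row_sub //
  rowK enum_rankK.
Qed.

Lemma row_family_biorthogonal_mul (I : finType) (x y : I -> 'rV[K]_n) :
  (forall i, dot (x i) (y i) != 0) ->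
  (forall i j, i != j -> dot (x i) (y j) = 0) ->
  row_family x *m (row_family y)^T \in unitmx.
Proof.
move=> xy0 xyN.
have -> : row_family x *m (row_family y)^T =
    diag_mx (\row_i dot (x (enum_val i)) (y (enum_val i))).
  apply/matrixP => i j; rewrite row_family_mul !mxE.
  have [->|nij] := eqVneq i j; first by rewrite mulr1n.
  by rewrite mulr0n xyN // (inj_eq enum_val_inj).
rewrite unitmxE det_diag unitfE; apply/prodf_neq0 => i _.
by rewrite mxE.
Qed.

(** An invertible diagonal matrix of size [#|I|] factors through dimension [n]. Two families are
    allowed because a space that is not totally isotropic only supplies a pair of vectors with
    nonzero product. *)
Lemma biorthogonal_card (I : finType) (x y : I -> 'rV[K]_n) :
  (forall i, dot (x i) (y i) != 0) ->
  (forall i j, i != j -> dot (x i) (y j) = 0) ->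
  (#|I| <= n)%N.
Proof.
move=> xy0 xyN; have := row_family_biorthogonal_mul xy0 xyN.
rewrite -row_free_unit => /eqP <-.
exact: leq_trans (mxrankM_maxl _ _) (rank_leq_col _).
Qed.

(** The spans of [x] and [u] meet trivially and both lie in the orthogonal complement of [u], whose
    dimension is [n - \rank U]. *)
Lemma isotropic_rank (I J : finType) (x : I -> 'rV[K]_n) (u : J -> 'rV[K]_n) :
  (forall i, dot (x i) (x i) != 0) ->
  (forall i j, i != j -> dot (x i) (x j) = 0) ->
  (forall i j, dot (u i) (u j) = 0) ->
  (forall i j, dot (x i) (u j) = 0) ->
  (2 * \rank (row_family u) + #|I| <= n)%N.
Proof.
move=> xx0 xxN uu xu.
have unitX := row_family_biorthogonal_mul xx0 xxN.
set X := row_family x in unitX *; set U := row_family u.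
have XU : X *m U^T = 0 by apply/matrixP => i j; rewrite row_family_mul xu mxE.
have UU : U *m U^T = 0 by apply/matrixP => i j; rewrite row_family_mul uu mxE.
have UX : U *m X^T = 0 by rewrite -[U]trmxK -trmx_mul XU trmx0.
have rX : \rank X = #|I|.
  apply/eqP; rewrite eqn_leq rank_leq_row.
  have := unitX; rewrite -row_free_unit => /eqP {1}<-.
  exact: mxrankM_maxl.
have cap0 : (X :&: U)%MS = 0.
  apply/eqP; rewrite -submx0; apply/row_subP => i.
  have /submxP[a ra] : (row i (X :&: U) <= X)%MS.
    exact: submx_trans (row_sub _ _) (capmxSl _ _).
  have /submxP[b rb] : (row i (X :&: U) <= U)%MS.
    exact: submx_trans (row_sub _ _) (capmxSr _ _).
  (* A common vector is orthogonal to [X], so the invertible Gram matrix of [X] kills its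
     coordinates [a]. *)
  have a0 : a *m (X *m X^T) = 0 by rewrite mulmxA -ra rb -mulmxA UX mulmx0.
  by rewrite ra -[a](mulmxK unitX) a0 mul0mx mul0mx sub0mx.
have : (X + U <= kermx U^T)%MS.
  by rewrite addsmx_sub !sub_kermx XU UU !eqxx.
move/mxrankS; rewrite mxrank_disjoint_sum // rX mxrank_ker mxrank_tr.
have := rank_leq_col U; lia.
Qed.

Definition charv (A : {set 'I_n}) : 'rV[K]_n := \row_i (i \in A)%:R.

Lemma dot_charv (A B : {set 'I_n}) : dot (charv A) (charv B) = #|A :&: B|%:R.
Proof.
rewrite /dot mxE -sum1_card natr_sum [RHS]big_mkcond; apply: eq_bigr => i _.
by rewrite !mxE inE -natrM mulnb; case: ifP.
Qed.

(* On the [\rank M] columns carrying an invertible minor of a row base, a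
   vector of the row space is determined by its entries. *)
Lemma card_charv_sub m (M : 'M[K]_(m, n)) :
  (#|[set A | (charv A <= M)%MS]| <= 2 ^ \rank M)%N.
Proof.
have full : row_full (row_base M)^T.
  by rewrite /row_full mxrank_tr; exact: row_base_free.
pose f := fullrankfun full.
have unitB := fullrowsub_unit full.
have baseE A : (charv A <= row_base M)%MS = (charv A <= M)%MS by rewrite eq_row_base.
have inj : {in [set A | (charv A <= M)%MS] &,
    injective (fun A : {set 'I_n} => f @^-1: A)}.
  move=> A B; rewrite !inE -!baseE => /submxP[a Ea] /submxP[b Eb] /setP EAB.
  have Eab : rowsub f (row_base M)^T *m a^T = rowsub f (row_base M)^T *m b^T.
    rewrite !mul_rowsub_mx -!trmx_mul -Ea -Eb.
    by apply/matrixP => i j; rewrite !mxE; have := EAB i; rewrite !inE => ->.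
  have {}Eab : charv A = charv B.
    by rewrite Ea Eb; congr (_ *m _); apply/trmx_inj/(can_inj (mulKmx unitB)).
  apply/setP => i; move/rowP/(_ i): Eab; rewrite !mxE.
  by case: (i \in A); case: (i \in B) => // /eqP;
    rewrite ?oner_eq0 // eq_sym oner_eq0.
rewrite -(card_in_imset inj) -[X in (_ <= 2 ^ X)%N]card_ord -cardsT -card_powerset.
by apply: subset_leq_card; apply/subsetP => Y _; rewrite powersetE subsetT.
Qed.
End Linear.

(** * The bound, under an explicit lower bound on [n] *)

Section Oddtown.
Set Implicit Arguments.
Unset Strict Implicit.

Lemma defect_oddtown_bound (l d n s : nat) (F : {set {set 'I_n}}) :
  prime l -> defect_oddtown d l F -> (2 ^ s <= d.+1)%N -> (4 * s * d.+2 <= n)%N ->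
  (#|F| <= d.+1 * (n - 2 * s))%N.
Proof.
move=> pl oddF le_s le_n.
pose v := @charv 'F_l n.
pose e (A B : {set 'I_n}) := ~~ (l %| #|A :&: B|)%N.
have dotE A B : (dot (v A) (v B) == 0) = ~~ e A B.
  by rewrite dot_charv -(dvdn_pcharf (pchar_Fp pl)) negbK.
have dot0 A B : ~~ e A B -> dot (v A) (v B) = 0 by rewrite -dotE => /eqP.
have e_sym : symmetric e by move=> A B; rewrite /e setIC.
have e_refl : {in F, forall A, e A A}.
  by move=> A AF; rewrite /e setIid; case: (oddF A AF).
have nbhd_le : {in F, forall A, (#|nbhd e F A| <= d.+1)%N}.
  move=> A AF; have [_ le_d] := oddF A AF.
  (* Neighbourhoods are closed: [A] itself accounts for the 1 in [d.+1]. *)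
  rewrite (cardsD1 A) -add1n leq_add ?leq_b1 // (leq_trans _ le_d) //.
  by apply/subset_leq_card/subsetP => B; rewrite !inE => /and3P[-> -> /=].
have [S [G [SF /independentP indS GS leF goodG]]] :=
  maximum_independent_good e_sym e_refl nbhd_le.
have vv0 (A : {A | A \in S}) : dot (v (val A)) (v (val A)) != 0.
  by rewrite dotE negbK e_refl // (subsetP SF) // (valP A).
have vvN (A B : {A | A \in S}) : A != B -> dot (v (val A)) (v (val B)) = 0.
  by move=> nAB; apply/dot0/indS; rewrite ?(valP A) ?(valP B) // (inj_eq val_inj).
have cardS : #|{: {A | A \in S}}| = #|S| by rewrite card_sig; apply: eq_card.
have cardG : #|{: {A | A \in G}}| = #|G| by rewrite card_sig; apply: eq_card.
have le_Sn : (#|S| <= n)%N by rewrite -cardS; apply: biorthogonal_card vv0 vvN.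
have cardSG : (#|S| = #|G| + #|S :\: G|)%N by rewrite -(cardsID G S) (setIidPr GS).
pose u A B : 'rV['F_l]_n := v B - (dot (v B) (v A) / dot (v A) (v A)) *: v A.
have uS A B X : A \in G -> B \in nbhd e F A -> X \in S -> dot (u A B) (v X) = 0.
  move=> AG Bn XS; have AS := subsetP GS _ AG; rewrite dotBl dotZl.
  have [->|nXA] := eqVneq X A.
    by rewrite divfK ?subrr // dotE negbK e_refl // (subsetP SF).
  rewrite (dot0 A X) ?indS // 1?eq_sym // mulr0 subr0 dot0 //.
  have [_ /(_ B Bn)[disj _]] := goodG A AG.
  have /(disjointFl disj) : X \in S :\ A by rewrite !inE nXA.
  by rewrite inE (subsetP SF) //= => ->.
have uu A A' B B' : A \in G -> A' \in G -> A != A' ->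
    B \in nbhd e F A -> B' \in nbhd e F A' -> dot (u A B) (u A' B') = 0.
  move=> AG A'G nA Bn B'n.
  rewrite dotBl dotZl (dotC (v A) (u A' B')) uS ?(subsetP GS) // mulr0 subr0 dotC.
  have [_ /(_ B Bn)[disjS disjG]] := goodG A AG.
  have nA' : A' != A by rewrite eq_sym.
  have A'S := subsetP GS _ A'G.
  have /(disjointFl disjS) : A' \in S :\ A by rewrite !inE nA'.
  rewrite inE (subsetP SF) //= e_sym => /negbT nA'B.
  have := disjointFl (disjG A' A'G nA') B'n.
  have B'F : B' \in F by move: B'n; rewrite inE => /andP[].
  rewrite inE B'F /= e_sym => /negbT nB'B.
  by rewrite dotBl dotZl (dot0 A' B) // (dot0 B' B) // mulr0 subr0.
rewrite leqNgt; apply/negP => ltF.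
case: (boolP [exists A in G, forall B in nbhd e F A, forall B' in nbhd e F A,
    dot (u A B) (u A B') == 0]) => [/exists_inP[A AG /forall_inP iso] | noniso].
  pose J := {B | B \in nbhd e F A}.
  pose U := row_family (fun B : J => u A (val B)).
  have le_rank : (2 * \rank U + #|S| <= n)%N.
    rewrite -cardS; apply: isotropic_rank vv0 vvN _ _ => [B B'|X B].
      by have /forall_inP/(_ _ (valP B'))/eqP := iso _ (valP B).
    by rewrite dotC; apply: uS => //; [exact: valP B | exact: valP X].
  have lt_d : (d.+1 < 2 ^ (\rank U).+1)%N.
    have [<- _] := goodG A AG.
    apply: (@leq_trans (2 ^ \rank (v A + U)%MS)%N); last first.
      rewrite leq_exp2l // (leq_trans (mxrank_adds_leqif _ _)) //.
      by rewrite -[leqRHS]add1n leq_add2r rank_leq_row.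
    apply: leq_trans (card_charv_sub _).
    (* The empty set is never a neighbour; counting it makes the inequality strict, which yields
       [s <= \rank U]. *)
    have -> : (#|nbhd e F A|).+1 = #|set0 |: nbhd e F A|.
      by rewrite cardsU1 inE [e A _]/e setI0 cards0 dvdn0 andbF.
    apply: subset_leq_card; apply/subsetP => B; rewrite in_setU1 inE.
    case/predU1P => [->|Bn].
      rewrite (_ : charv _ _ = 0) ?sub0mx //.
      by apply/rowP => i; rewrite !mxE inE.
    rewrite -/v -[v B](subrK ((dot (v B) (v A) / dot (v A) (v A)) *: v A)) addrC.
    rewrite addmx_sub_adds ?scalemx_sub //.
    exact: (row_family_sub (fun B : J => u A (val B)) (exist _ B Bn)).
  have le_s_rank : (s <= \rank U)%N.
    by rewrite -ltnS -(ltn_exp2l _ _ (isT : (1 < 2)%N)) (leq_ltn_trans le_s).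
  (* Now [#|S| <= n - 2 * s], so the edge count alone contradicts [ltF]. *)
  have le_r : (#|S| * d.+1 <= d.+1 * (n - 2 * s))%N by rewrite mulnC leq_mul2l; lia.
  move: (leq_trans (leq_addr _ _) leF); rewrite leq_pmul2l // => /leq_trans/(_ le_r).
  by rewrite leqNgt ltF.
have noniso_pair (A : {A | A \in G}) : exists q : {set 'I_n} * {set 'I_n},
    [/\ q.1 \in nbhd e F (val A), q.2 \in nbhd e F (val A)
      & dot (u (val A) q.1) (u (val A) q.2) != 0].
  move: noniso; rewrite negb_exists_in => /forall_inP/(_ _ (valP A)).
  rewrite negb_forall_in => /exists_inP[B Bn].
  by rewrite negb_forall_in => /exists_inP[B' B'n uBB']; exists (B, B').
have [p pP] := fin_all_exists noniso_pair.
(* Taking [q] to be [fst] and [snd] gives two families, biorthogonal even when every chosen vector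
   in some space is isotropic. *)
pose w (q : {set 'I_n} * {set 'I_n} -> {set 'I_n})
    (i : {A | A \in S} + {A | A \in G}) :=
  match i with inl A => v (val A) | inr A => u (val A) (q (p A)) end.
have le_SGn : (#|S| + #|G| <= n)%N.
  rewrite -cardS -cardG -card_sum; apply: (@biorthogonal_card _ _ _ (w fst) (w snd)).
    by move=> [A|A]; [exact: vv0 | have [] := pP A].
  move=> [A|A] [B|B] /= nAB.
  - by apply: vvN; apply: contraNneq nAB => ->.
  - by have [_ Bn _] := pP B; rewrite dotC; apply: uS => //;
      [exact: valP B | exact: valP A].
  - by have [An _ _] := pP A; apply: uS => //; [exact: valP A | exact: valP B].
  - have [An _ _] := pP A; have [_ Bn _] := pP B.
    by apply: uu => //; [exact: valP A | exact: valP B].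
(* Put b = [#|S :\: G|]. The edge count gives b + 2t(d+1) < 4s(d+1), and [le_SGn] gives n <= 2t + b;
   hence n < 4s(d+1), against [le_n]. *)
have [t nE] : exists t, (#|S| + t = n)%N by exists (n - #|S|)%N; rewrite subnKC.
have [k kE] : exists k, (2 * s + k = n)%N.
  by exists (n - 2 * s)%N; rewrite subnKC // (leq_trans _ le_n) // mulnAC; lia.
have le_t : (t <= t * d.+1)%N by rewrite leq_pmulr.
have prodE : (#|S| * d.+1 + t * d.+1 = 2 * (s * d.+1) + k * d.+1)%N.
  by rewrite mulnA -!mulnDl nE kE.
have nk : (n - 2 * s = k)%N by rewrite -kE addKn.
rewrite nk mulnC in ltF.
have {}le_n : (4 * (s * d.+1) <= n)%N.
  by rewrite mulnA (leq_trans _ le_n) // leq_mul2l leqnSn orbT.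
clear -nE kE le_t prodE ltF le_n leF cardSG le_SGn.
move: (#|S| * d.+1)%N (t * d.+1)%N (s * d.+1)%N (k * d.+1)%N
  le_t prodE ltF le_n leF => rm tm sm km.
move: #|F| #|S| #|G| #|S :\: G| cardSG le_SGn nE => f r g b.
lia.
Qed.
End Oddtown.

(** * Logarithm estimates and the absolute constant *)

Section Log.
Variable R : realType.

Lemma ln2_ge_half : 1 / 2 <= ln 2 :> R.
Proof.
have := @le_ln1Dx R (- (1 / 2)) ltac:(lra).
rewrite (_ : 1 + - (1 / 2) = 2^-1) ?lnV ?posrE //; last by field.
by lra.
Qed.

(** From 2^s <= d+1 < 2^(s+1) follows 2^s < d+2 <= 2^(s+1), by integrality. *)
Lemma ceil_log2D2 d :
  Num.ceil (log2 (d%:R + 2 : R)) = (trunc_log 2 d.+1).+1%:Z.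
Proof.
have ln2 : 0 < ln 2 :> R by rewrite ln_gt0 // ltr1n.
have /andP[lo hi] := trunc_log_bounds (isT : (1 < 2)%N) (ltn0Sn d).
set s := trunc_log 2 d.+1 in lo hi *.
have lnpow k : k%:R * ln 2 = ln (2 ^ k)%:R :> R.
  by rewrite natrX lnXn // mulr_natl.
have -> : d%:R + 2 = d.+2%:R :> R by rewrite -natrD addn2.
apply: ceil_def; rewrite -[s.+1]addn1 PoszD addrK.
rewrite -!pmulrn /log2 ltr_pdivlMr // ler_pdivrMr // addn1 !lnpow.
by rewrite ltr_ln ?ler_ln ?posrE ?ltr0n ?expn_gt0 // ltr_nat ler_nat; apply/andP.
Qed.

(** Since 2^s <= d+1 <= d^2, s ln 2 <= 2 ln d; and ln 2 >= 1/2. *)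
Lemma trunc_log2_le d : (2 <= d)%N -> (trunc_log 2 d.+1)%:R <= 4 * ln d%:R :> R.
Proof.
move=> d2; have half := ln2_ge_half.
have := trunc_logP (isT : (1 < 2)%N) (ltn0Sn d).
set s := trunc_log 2 d.+1 => lo.
have : ln (2 ^ s)%:R <= ln (d ^ 2)%:R :> R.
  by rewrite ler_ln ?posrE ?ltr0n ?expn_gt0 ?(ltnW d2) // ler_nat; nia.
rewrite !natrX !lnXn ?ltr0n ?(ltnW d2) // -(mulr_natr (ln 2)) -(mulr_natr (ln d%:R)).
have := ler_wpM2l (ler0n R s) half.
by lra.
Qed.
End Log.

(* For d = 1 the threshold C * d * ln d is 0 and the bound 2 * (n - 2) fails
   for n <= 3 (take the n singletons), so "n >= C d log d" is read there as
   n >= C; for d >= 2 the extra hypothesis is vacuous. The bound is an integer,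
   without truncated subtraction. *)
Theorem theorem1p6 (R : realType) :
  exists C : R, 0 < C /\
    forall (l d n : nat) (F : {set {set 'I_n}}),
      prime l -> (1 <= d)%N ->
      C * d%:R * ln (d%:R : R) <= n%:R ->
      (d = 1%N -> C <= n%:R) ->
      defect_oddtown d l F ->
      (#|F|%:Z <= (d%:Z + 1) *
        (n%:Z - 2 * (Num.ceil (log2 ((d%:R + 2) : R)) - 1)))%R.
Proof.
(* For d >= 2, s <= 4 ln d and d+2 <= 2d give 4s(d+2) <= 32 d ln d; for d = 1, s = 1 and 4s(d+2) =
   12 <= 32. *)
exists 32; split => // l d n F pl d1 le_n le_n1 oddF.
rewrite ceil_log2D2; set s := trunc_log 2 d.+1.
have le_s : (2 ^ s <= d.+1)%N by apply: trunc_logP.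
have {le_n le_n1} le_n : (4 * s * d.+2 <= n)%N.
  move: d1; rewrite leq_eqVlt => /predU1P[d1 | d2].
    move: (le_n1 (esym d1)); rewrite ler_nat /s -d1.
    by rewrite (_ : trunc_log 2 2 = 1%N) ?trunc_lognn //; lia.
  rewrite -(ler_nat R); apply: le_trans le_n.
  have := @trunc_log2_le R d d2; rewrite -/s.
  have d2R : d.+2%:R <= 2 * d%:R :> R by rewrite -natrM ler_nat; lia.
  move=> /(ler_wpM2l (ler0n R d)); have := ler_wpM2l (ler0n R s) d2R.
  by rewrite !natrM; lra.
(* This makes the truncated [n - 2 * s] agree with integer subtraction. *)
have le_2s : (2 * s <= n)%N by rewrite (leq_trans _ le_n) // mulnAC; lia.
have := defect_oddtown_bound pl oddF le_s le_n.
by rewrite -lez_nat PoszM -subzn // -(addn1 d) -(addn1 s) !PoszD addrK.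
Qed.
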